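(* Let $\mathcal{X}$ be a Polish space with its Borel $\sigma$-algebra, and let $\mathcal{P}$ and $\mathcal{P}_n$ ($n\ge 1$) be nonempty, weakly compact, convex sets of Borel probability measures on $\mathcal{X}$. If $\lim_{n\to\infty}V(\mathcal{P}_n,\mathcal{P})=0$, then $\mathbb{E}^{\mathcal{P}_n}[\cdot]$ converges weakly to $\mathbb{E}^{\mathcal{P}}[\cdot]$, i.e. $\lim_{n\to\infty}\mathbb{E}^{\mathcal{P}_n}[\varphi]=\mathbb{E}^{\mathcal{P}}[\varphi]$ for every $\varphi\in C_b(\mathcal{X})$.
   Context: ''Weakly compact'' means compact in the topology of weak convergence of probability measures; $C_b(\mathcal{X})$ is the set of bounded continuous real functions on $\mathcal{X}$. For probability measures $\mu,\nu$, $V(\mu,\nu)=\sup_{A}|\mu(A)-\nu(A)|$ over Borel sets $A$. For sets of probability measures, $V(\mathcal{P},\mathcal{Q}):=\max\left(\sup_{\mu\in\mathcal{P}}\inf_{\nu\in\mathcal{Q}}V(\mu,\nu),\ \sup_{\nu\in\mathcal{Q}}\inf_{\mu\in\mathcal{P}}V(\mu,\nu)\right)$. The sublinear expectation is $\mathbb{E}^{\mathcal{P}}[\varphi]:=\sup_{\mu\in\mathcal{P}}\int\varphi\,d\mu$. *)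

(* Defs.v *)
From HB Require Import structures.
From mathcomp Require Import all_boot all_order all_algebra.
From mathcomp Require Import all_classical all_reals all_analysis.
Set Implicit Arguments.
Unset Strict Implicit.
Unset Printing Implicit Defensive.
Import Order.TTheory GRing.Theory Num.Theory.
Import numFieldNormedType.Exports.

Local Open Scope classical_set_scope.
Local Open Scope ring_scope.

(* A topological property: [X] is separable and homeomorphic to a metric space
   whose Cauchy filters converge; no metric on [X] itself is fixed. *)
Definition polish (R : realType) (X : topologicalType) : Prop :=
  (exists2 D : set X, countable D & dense D) /\
  exists (M : metricType R) (h : X -> M) (g : M -> X),
    [/\ cancel h g, cancel g h, continuous h, continuous g &
        forall F : set_system M, ProperFilter F -> cauchy F ->
          exists l : M, F --> l].

Definition borel (X : ptopologicalType) := g_sigma_algebraType (@open X).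

Definition Cb (R : realType) (X : topologicalType) : set (X -> R) :=
  [set phi | continuous phi /\ bounded_fun phi].
Arguments Cb : clear implicits.

Section sets_of_probabilities.
Context (R : realType) (X : ptopologicalType).
Local Notation prob := (probability (borel X) R).
Implicit Types (P Q : set prob) (mu nu : prob).

Definition Cb_integrals mu : {ptws Cb R X -> R} :=
  fun phi => (\int[mu]_x (\val phi x))%R.

(* The topology of weak convergence: the coarsest topology on [prob] that makes
   [mu |-> \int[mu]_x phi x] continuous for every [phi] in [Cb R X]. *)
Definition weak_prob := initial_topology Cb_integrals.
HB.instance Definition _ := Topological.on weak_prob.

Definition weakly_compact P : Prop := compact (P : set weak_prob).

(* Two elements of [prob] that agree on the Borel sets represent the same
   probability measure but may differ as functions [set X -> \bar R], so
   the mixture is only required to have a representative in [P]. *)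
Definition convex_probs P : Prop :=
  forall mu nu, P mu -> P nu -> forall t : R, 0 <= t <= 1 ->
    exists2 rho, P rho & forall A, measurable A ->
      rho A = (t%:E * mu A + (1 - t)%:E * nu A)%E.

Local Open Scope ereal_scope.

Definition tv_dist mu nu : \bar R :=
  ereal_sup [set `|mu A - nu A| | A in measurable].

Definition tv_Hausdorff P Q : \bar R :=
  maxe (ereal_sup [set ereal_inf [set tv_dist mu nu | nu in Q] | mu in P])
       (ereal_sup [set ereal_inf [set tv_dist mu nu | mu in P] | nu in Q]).

Definition sublinear_expectation P (phi : X -> R) : \bar R :=
  ereal_sup [set \int[mu]_x (phi x)%:E | mu in P].

End sets_of_probabilities.

(* Main.v *)
Require Import Defs.
From HB Require Import structures.
From mathcomp Require Import all_boot all_order all_algebra.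
From mathcomp Require Import all_classical all_reals all_analysis.
From mathcomp Require Import measurable_realfun lra.
Set Implicit Arguments.
Unset Strict Implicit.
Unset Printing Implicit Defensive.

Import Order.TTheory GRing.Theory Num.Theory.
Import numFieldNormedType.Exports.

(** Integration against a bounded function is Lipschitz for total variation,
    uniformly in the measures: if [`|f| <= M] and [mu A <= nu A + e] for all
    [A], then [\int f dmu <= \int f dnu + 2 * M * e].  Indeed [f + M] has values
    in [[0, 2 * M]], so its integral is that of its tail probabilities over
    [[0, 2 * M]], and each tail probability changes by at most [e]
    ([ge0_integral_le_of_measure_le], [integral_le_of_measure_le]).

    If every measure of [P] lies at distance less than [e] from some measure of
    [Q], this estimate passes to suprema: [E^P f <= E^Q f + 2 * M * e]
    ([sublinear_expectation_le]).  A Hausdorff distance below [e] gives this in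
    both directions, so that [E^(Pn n) phi] and [E^P phi], which are finite
    because [phi] is bounded, differ by at most [2 * M * e]. *)

Local Open Scope classical_set_scope.
Local Open Scope ring_scope.

Section bounded_integrals.
Context d (T : measurableType d) (R : realType).
Implicit Types (mu nu : probability T R) (f : T -> R).

Local Open Scope ereal_scope.

Lemma bounded_integrable_probability mu f (M : R) :
  measurable_fun setT f -> (forall x, `|f x| <= M)%R ->
  mu.-integrable setT (EFin \o f).
Proof.
move=> mf fM; apply: measurable_bounded_integrable => //.
  by apply: (le_lt_trans (probability_le1 _ _)) => //; rewrite ltry.
exists M; split => [|x Mx y _ /=]; first exact: num_real.
exact/ltW/(le_lt_trans _ Mx).
Qed.

Lemma bounded_integral_fin_num mu f (M : R) :
  measurable_fun setT f -> (forall x, `|f x| <= M)%R ->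
  \int[mu]_x (f x)%:E \is a fin_num.
Proof.
move=> mf fM; apply: integrable_fin_num => //.
exact: bounded_integrable_probability fM.
Qed.

Lemma bounded_integral_le mu f (M : R) :
  measurable_fun setT f -> (forall x, `|f x| <= M)%R ->
  \int[mu]_x (f x)%:E <= M%:E.
Proof.
move=> mf fM; rewrite -[leRHS]mule1 -(@probability_setT _ _ _ mu) -integral_cst//.
apply: le_integral => //.
- exact: bounded_integrable_probability fM.
- exact: finite_measure_integrable_cst.
- by move=> x _; rewrite lee_fin (le_trans (ler_norm _)).
Qed.

(** Layer-cake formula: [\int f dmu] integrates [mu (f > r)] over [r >= 0], and
    these tails vanish for [r >= K]; the error [e] is thus paid only on an
    interval of length [K]. *)
Lemma ge0_integral_le_of_measure_le mu nu f (K e : R) :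
  measurable_fun setT f -> (forall x, 0 <= f x <= K)%R -> (0 <= e)%R ->
  (forall A, measurable A -> mu A <= nu A + e%:E) ->
  \int[mu]_x (f x)%:E <= \int[nu]_x (f x)%:E + (K * e)%:E.
Proof.
move=> mf f0K e0 munu.
have f0 x : (0 <= f x)%R by case/andP: (f0K x).
have K0 : (0 <= K)%R by case/andP: (f0K point) => /le_trans; exact.
pose fX : {mfun T >-> R} := mfun_Sub (mem_set mf).
have tail (la : probability T R) : \int[la]_x (f x)%:E =
    \int[lebesgue_measure]_(r in `[0%R, +oo[) la (f @^-1` `]r, +oo[).
  have := @ge0_expectation_ccdf _ _ _ la fX f0.
  by rewrite expectation_def.
have mtail (la : probability T R) :
    measurable_fun setT ((fun r => la (f @^-1` `]r, +oo[)) : R -> \bar R).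
  exact: (@ccdf_measurable _ _ _ la fX).
have mind :
    measurable_fun setT ((fun r => e%:E * (\1_`[0%R, K] r)%:E) : R -> \bar R).
  by apply: measurable_funeM; apply/measurable_EFinP; exact: measurable_indic.
have mind1 : measurable_fun setT (fun r : R => (\1_`[0%R, K] r : R)%:E).
  by apply/measurable_EFinP; exact: measurable_indic.
have -> : (K * e)%:E =
    \int[@lebesgue_measure R]_(r in `[0%R, +oo[) (e%:E * (\1_`[0%R, K] r)%:E).
  rewrite ge0_integralZl//; last exact: (measurable_funTS mind1).
  rewrite integral_indic//= setIidl; last first.
    by move=> r /=; rewrite !in_itv/= => /andP[->].
  rewrite lebesgue_measure_itv/= lte_fin muleC.
  have [_|K0'] := ltP 0%R K; first by rewrite sube0 -EFinM.
  by have -> : K = 0%R by apply/eqP; rewrite eq_le K0 K0'.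
rewrite !tail -ge0_integralD//=; last 3 first.
- exact: (measurable_funTS (mtail nu)).
- by move=> r _; rewrite mule_ge0.
- exact: (measurable_funTS mind).
apply: ge0_le_integral => //=.
- exact: (measurable_funTS (mtail mu)).
- exact: (measurable_funTS (emeasurable_funD (mtail nu) mind)).
- move=> r; rewrite in_itv/= andbT => r0.
  have [rK|Kr] := leP r K.
    rewrite indicE mem_set/= ?in_itv/= ?r0 ?rK// mule1; apply: munu.
    by rewrite -[X in measurable X]setTI; exact: (mf measurableT _ (measurable_itv _)).
  rewrite [X in mu X](_ : _ = set0) ?measure0 ?adde_ge0 ?mule_ge0//.
  rewrite -subset0 => x /=; rewrite in_itv/= andbT => rf.
  have := lt_le_trans (lt_trans Kr rf) (proj2 (andP (f0K x))).
  by rewrite ltxx.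
Qed.

(** Adding the constant [M] makes [f] nonnegative and, as [mu] and [nu] have the
    same total mass, changes both integrals by the same amount. *)
Lemma integral_le_of_measure_le mu nu f (M e : R) :
  measurable_fun setT f -> (forall x, `|f x| <= M)%R -> (0 <= e)%R ->
  (forall A, measurable A -> mu A <= nu A + e%:E) ->
  \int[mu]_x (f x)%:E <= \int[nu]_x (f x)%:E + (2 * M * e)%:E.
Proof.
move=> mf fM e0 munu.
have shift (la : probability T R) :
    \int[la]_x (f x + M)%:E = \int[la]_x (f x)%:E + M%:E.
  rewrite -[X in _ + X]mule1 -(@probability_setT _ _ _ la) -integral_cst//.
  apply: (@integralD_EFin _ _ _ la setT measurableT f (cst M)).
    exact: bounded_integrable_probability fM.
  exact: finite_measure_integrable_cst.
have := @ge0_integral_le_of_measure_le mu nu (fun x => f x + M)%R (2 * M) e.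
rewrite !shift addeAC leeD2rE//; apply => //.
- exact: measurable_funD.
- by move=> x; have := fM x; rewrite ler_norml => /andP[]; lra.
Qed.

End bounded_integrals.

Section sublinear_expectations.
Context (R : realType) (X : ptopologicalType).
Implicit Types (P Q : set (probability (borel X) R)).
Implicit Types (mu nu : probability (borel X) R).
Local Open Scope ereal_scope.

Lemma continuous_borel_measurable (f : X -> R) : continuous f ->
  measurable_fun setT (f : borel X -> R).
Proof.
move=> /continuousP cf; apply: (measurability _ (RGenOpens.measurableE R)).
move=> _ [_ [a [b ->] <-]]; rewrite setTI; apply: sub_sigma_algebra.
exact/cf/interval_open.
Qed.

Lemma tv_distC mu nu : tv_dist mu nu = tv_dist nu mu.
Proof.
congr ereal_sup; apply: eq_imagel => A mA.
by rewrite -abseN fin_num_oppeB ?fin_num_measure// addeC.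
Qed.

Lemma measure_le_tv_dist mu nu (e : R) A : measurable A ->
  tv_dist mu nu <= e%:E -> mu A <= nu A + e%:E.
Proof.
move=> mA mne; rewrite -leeBlDl ?fin_num_measure//.
apply: le_trans (lee_abs _) _; apply: le_trans mne.
by apply: ereal_sup_ubound; exists A.
Qed.

Lemma sublinear_expectation_fin_num P (f : X -> R) (M : R) :
  measurable_fun setT (f : borel X -> R) -> (forall x, `|f x| <= M)%R ->
  P !=set0 -> sublinear_expectation P f \is a fin_num.
Proof.
move=> mf fM [mu Pmu]; rewrite fin_numElt; apply/andP; split.
  apply: (@lt_le_trans _ _ (\int[mu]_x (f x)%:E)).
    by rewrite ltNye_eq (bounded_integral_fin_num mu mf fM).
  by apply: ereal_sup_ubound; exists mu.
apply: (@le_lt_trans _ _ M%:E); last exact: ltry.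
by apply: ge_ereal_sup => _ [nu _ <-]; exact: bounded_integral_le.
Qed.

(** The strict bound on the infimum provides an actual [nu] in [Q] closer than
    [e] to [mu]. *)
Lemma sublinear_expectation_le P Q (f : X -> R) (M e : R) :
  measurable_fun setT (f : borel X -> R) -> (forall x, `|f x| <= M)%R ->
  (0 <= e)%R ->
  (forall mu, P mu -> ereal_inf [set tv_dist mu nu | nu in Q] < e%:E) ->
  sublinear_expectation P f <= sublinear_expectation Q f + (2 * M * e)%:E.
Proof.
move=> mf fM e0 PQ; apply: ge_ereal_sup => _ [mu Pmu <-].
have [_ [nu Qnu <-] /ltW mne] := ereal_inf_lt (PQ mu Pmu).
apply: (@le_trans _ _ (\int[nu]_x (f x)%:E + (2 * M * e)%:E)).
  by apply: integral_le_of_measure_le => // A mA; exact: measure_le_tv_dist.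
by rewrite leeD2r//; apply: ereal_sup_ubound; exists nu.
Qed.

Lemma tv_Hausdorff_lt P Q (e : R) : tv_Hausdorff P Q < e%:E ->
  (forall mu, P mu -> ereal_inf [set tv_dist mu nu | nu in Q] < e%:E) /\
  (forall nu, Q nu -> ereal_inf [set tv_dist nu mu | mu in P] < e%:E).
Proof.
rewrite /tv_Hausdorff gt_max => /andP[PQ QP]; split=> mu Pmu.
  by apply: le_lt_trans PQ; apply: ereal_sup_ubound; exists mu.
apply: le_lt_trans QP; apply: ereal_sup_ubound; exists mu => //.
by congr ereal_inf; apply: eq_imagel => nu _; exact: tv_distC.
Qed.

End sublinear_expectations.

Theorem theorem10 (R : realType) (X : ptopologicalType) (polX : polish R X)
    (P : set (probability (borel X) R))
    (Pn : nat -> set (probability (borel X) R))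
    (P_neq0 : P !=set0) (P_compact : weakly_compact P)
    (P_convex : convex_probs P)
    (Pn_neq0 : forall n, (1 <= n)%N -> Pn n !=set0)
    (Pn_compact : forall n, (1 <= n)%N -> weakly_compact (Pn n))
    (Pn_convex : forall n, (1 <= n)%N -> convex_probs (Pn n))
    (VPnP : tv_Hausdorff (Pn n) P @[n --> \oo] --> 0%E) :
  forall phi : X -> R, Cb R X phi ->
    sublinear_expectation (Pn n) phi @[n --> \oo] -->
      sublinear_expectation P phi.
Proof.
move=> phi [/continuous_borel_measurable mphi [M0 [_ bphi]]].
pose M := Num.max (M0 + 1) 1.
have M1 : 1 <= M by rewrite le_max lexx orbT.
have phiM x : `|phi x| <= M.
  by apply: bphi => //; rewrite lt_max ltrDl ltr01.
have finP := sublinear_expectation_fin_num mphi phiM P_neq0.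
have finPn n : (1 <= n)%N -> sublinear_expectation (Pn n) phi \is a fin_num.
  by move=> n1; exact: (sublinear_expectation_fin_num mphi phiM (Pn_neq0 _ n1)).
rewrite -(fineK finP); apply/fine_cvgP; split.
  by near=> n; apply: finPn; near: n; exact: nbhs_infty_ge.
apply/cvgrPdist_le => e e0.
pose d := e / (2 * M).
have d0 : 0 < d by rewrite divr_gt0// mulr_gt0//; lra.
have MdE : 2 * M * d = e by rewrite /d mulrC divfK//; lra.
near=> n.
have n1 : (1 <= n)%N by near: n; exact: nbhs_infty_ge.
have /tv_Hausdorff_lt[PnP PPn] : (tv_Hausdorff (Pn n) P < d%:E)%E.
  near: n; apply: (VPnP [set y | (y < d%:E)%E]).
  exact: (@nbhs_open_ereal_lt _ 0 (fun=> d)).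
have := sublinear_expectation_le mphi phiM (ltW d0) PnP.
have := sublinear_expectation_le mphi phiM (ltW d0) PPn.
rewrite MdE -(fineK finP) -(fineK (finPn n n1)) -!EFinD !lee_fin /= => le1 le2.
by rewrite ler_norml; apply/andP; split; lra.
Unshelve. all: by end_near.
Qed.
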